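(* Let $t\in\mathbb R\setminus\{0\}$. The sum and the $\star$-product of two rational functions of compatible sizes are rational. If $f$ is a square rational function whose value at the origin is invertible, then its $\star$-inverse $f^{-\star}$ is rational.
   Context: For $t\in\mathbb R\setminus\{0\}$, $\mathbb H_t$ is the real algebra (matrix addition and multiplication) of matrices $q_t=\begin{pmatrix}a&tb\\ \overline b&\overline a\end{pmatrix}$, $a,b\in\mathbb C$; $\mathbb H_t^{n\times m}$ denotes $n\times m$ matrices with entries in $\mathbb H_t$. The variable $q_t\in\mathbb H_t$ multiplies a matrix entrywise from the left. For power series with matrix coefficients of compatible sizes, the $\star$-product is $\left(\sum q_t^n\alpha_n\right)\star\left(\sum q_t^n\beta_n\right)=\sum_nq_t^n\sum_{k=0}^n\alpha_{n-k}\beta_k$, and $S^{-\star}$ is the inverse of a square $S$ with respect to $\star$. A power series $f(q_t)=\sum_{k=0}^\infty q_t^kf_k$ with $f_k\in\mathbb H_t^{n\times m}$, converging in a neighborhood of the origin, is called rational if there exist $N\in\mathbb N_0$ and matrices $(A,B,C)\in\mathbb H_t^{N\times N}\times\mathbb H_t^{N\times m}\times\mathbb H_t^{n\times N}$ such that, with $D=f(0)$, $f(q_t)=D+q_t\star C\star(I_N-q_t\star A)^{-\star}\star B$ (equivalently, $f_k=CA^{k-1}B$ for $k\ge1$). *)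

(* Defs.v *)
From HB Require Import structures.
From mathcomp Require Import all_boot all_order all_algebra complex.
From mathcomp Require Import all_classical all_reals all_analysis.
From mathcomp Require Import ring.

Set Implicit Arguments.
Unset Strict Implicit.
Unset Printing Implicit Defensive.

Import Order.TTheory GRing.Theory Num.Theory.
Import numFieldNormedType.Exports.

Local Open Scope classical_set_scope.
Local Open Scope ring_scope.
Local Open Scope complex_scope.

Section HtAlgebra.
Context {R : realType} (t : R).
Implicit Types (a b : R[i]) (M : 'M[R[i]]_2).

Definition qmat a b : 'M[R[i]]_2 :=
  \matrix_(i, j) if i == 0 then (if j == 0 then a else t%:C * b)
                 else (if j == 0 then conjc b else conjc a).

(* M 0 0 and the conjugate of M 1 0 are the only candidates for a and b. *)
Definition is_qmat : {pred 'M[R[i]]_2} :=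
  fun M => M == qmat (M 0 0) (conjc (M 1 0)).

Lemma is_qmatP M : reflect (exists a b, M = qmat a b) (M \in is_qmat).
Proof.
apply: (iffP eqP) => [->|[a [b ->]]]; first by do 2 eexists.
by rewrite !mxE /= conjcK.
Qed.

Lemma qmatE a b :
  (qmat a b 0 0 = a) * (qmat a b 0 1 = t%:C * b) *
  (qmat a b 1 0 = conjc b) * (qmat a b 1 1 = conjc a).
Proof. by rewrite !mxE. Qed.

Lemma eq_mx2 M (N : 'M[R[i]]_2) :
  M 0 0 = N 0 0 -> M 0 1 = N 0 1 -> M 1 0 = N 1 0 -> M 1 1 = N 1 1 -> M = N.
Proof.
move=> e00 e01 e10 e11; apply/matrixP => i j.
have ord2 (k : 'I_2) : k = 0 \/ k = 1.
  by case: k => [[|[|k]] kP]; [left; exact: val_inj|right; exact: val_inj|].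
by case: (ord2 i) => ->; case: (ord2 j) => ->.
Qed.

Lemma is_qmat_subring : subring_closed is_qmat.
Proof.
have ct : t -i* 0 = t%:C by rewrite oppr0.
split.
- apply/is_qmatP; exists 1, 0.
  by apply: eq_mx2; rewrite qmatE mxE /= ?mulr0 ?oppr0.
- move=> M N /is_qmatP[a [b ->]] /is_qmatP[c [d ->]]; apply/is_qmatP.
  exists (a - c), (b - d).
  by apply: eq_mx2; rewrite qmatE !mxE /= ?rmorphB ?mulrBr.
- move=> M N /is_qmatP[a [b ->]] /is_qmatP[c [d ->]]; apply/is_qmatP.
  exists (a * c + t%:C * b * conjc d), (a * d + b * conjc c).
  apply: eq_mx2; rewrite mxE 2!big_ord_recl big_ord0 !mxE addr0 /=.
  + by [].
  + by ring.
  + by rewrite rmorphD !rmorphM /= conjcK; ring.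
  + by rewrite rmorphD !rmorphM /= conjcK ct; ring.
Qed.

HB.instance Definition _ :=
  GRing.isSubringClosed.Build 'M[R[i]]_2 is_qmat is_qmat_subring.

Record Ht := MkHt { Ht_val :> 'M[R[i]]_2 ; _ : Ht_val \in is_qmat }.

HB.instance Definition _ := [isSub for Ht_val].
HB.instance Definition _ := [Choice of Ht by <:].
HB.instance Definition _ := [SubChoice_isSubNzRing of Ht by <:].

(* The topology induced by that of the 2 x 2 complex matrices; [(R[i])^o] is
   [R[i]] with its modulus topology. *)
HB.instance Definition _ := isPointed.Build Ht 0.
HB.instance Definition _ :=
  Topological.copy Ht (initial_topology (fun q : Ht => Ht_val q : 'M[(R[i])^o]_2)).

End HtAlgebra.

Lemma mx_hausdorff (T : topologicalType) n m :
  hausdorff_space T -> hausdorff_space 'M[T]_(n, m).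
Proof.
move=> hT p q pq; apply/matrixP => i j; apply: hT => A B pA qB.
have [||M [AM BM]] := pq [set M : 'M[T]_(n, m) | A (M i j)]
                          [set M : 'M[T]_(n, m) | B (M i j)].
- exists (fun i' j' => if (i' == i) && (j' == j) then A else setT).
    move=> i' j'; case: ifP => [/andP[/eqP-> /eqP->] //|_]; exact: filterT.
  by move=> M /(_ i j); rewrite !eqxx.
- exists (fun i' j' => if (i' == i) && (j' == j) then B else setT).
    move=> i' j'; case: ifP => [/andP[/eqP-> /eqP->] //|_]; exact: filterT.
  by move=> M /(_ i j); rewrite !eqxx.
- by exists (M i j).
Qed.

Lemma Ht_hausdorff (R : realType) (t : R) : hausdorff_space (Ht t).
Proof.
have hC : hausdorff_space 'M[(R[i])^o]_2 by apply/mx_hausdorff/norm_hausdorff.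
move=> p q pq; apply: val_inj; apply: hC => A B pA qB.
have vc := @initial_continuous _ _ (@Ht_val R t : Ht t -> 'M[(R[i])^o]_2).
by have [x [Ax Bx]] := pq _ _ (vc p _ pA) (vc q _ qB); exists (Ht_val x).
Qed.

(* A power series \sum_k q^k f_k is represented by its coefficient sequence
   k |-> f_k. *)
Definition mxseries (R : realType) (t : R) (n m : nat) :=
  nat -> 'M[Ht t]_(n, m).

Section PowerSeries.
Context {R : realType} {t : R}.
Local Notation H := (Ht t).
Local Notation mxseries := (mxseries t).

Definition ps_partial n m (f : mxseries n m) (q : H) (N : nat) : 'M[H]_(n, m) :=
  \sum_(k < N) q ^+ k *: f k.

(* Pointwise value f(q), meaningful where the series converges. *)
Definition ps_value n m (f : mxseries n m) (q : H) : 'M[H]_(n, m) :=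
  lim (ps_partial f q @ \oo).

Definition ps_converges_near0 n m (f : mxseries n m) : Prop :=
  \forall q \near (0 : H), cvg (ps_partial f q @ \oo).

Lemma ps_value0 n m (f : mxseries n m) : ps_value f 0 = f 0%N.
Proof.
apply: cvg_lim; first exact/mx_hausdorff/Ht_hausdorff.
apply: cvg_near_cst; exists 1%N => // -[//|N] _ /=.
rewrite /ps_partial big_ord_recl expr0 scale1r big1 ?addr0 // => k _.
by rewrite expr0n scale0r.
Qed.

Definition ps_cst n m (M : 'M[H]_(n, m)) : mxseries n m :=
  fun k => if k == 0%N then M else 0.

(* The series q * I_n. *)
Definition ps_var n : mxseries n n := fun k => if k == 1%N then 1%:M else 0.

Definition ps_add n m (f g : mxseries n m) : mxseries n m := fun k => f k + g k.

Definition ps_sub n m (f g : mxseries n m) : mxseries n m := fun k => f k - g k.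

Definition ps_star n p m (f : mxseries n p) (g : mxseries p m) : mxseries n m :=
  fun k => \sum_(i < k.+1) f (k - i)%N *m g i.

Definition ps_star_inverse n (f g : mxseries n n) : Prop :=
  ps_star f g =1 ps_cst 1%:M /\ ps_star g f =1 ps_cst 1%:M.

(* The entries of the matrices do not commute, so [unitmx] does not apply. *)
Definition mx_invertible n (M : 'M[H]_n) : Prop :=
  exists M' : 'M[H]_n, M *m M' = 1%:M /\ M' *m M = 1%:M.

(* [S] is the star-inverse of I_N - q * A, which is unique and always exists. *)
Definition has_realization n m (f : mxseries n m) : Prop :=
  exists (N : nat) (A : 'M[H]_N) (B : 'M[H]_(N, m)) (C : 'M[H]_(n, N))
         (S : mxseries N N),
    ps_star_inverse
      (ps_sub (ps_cst 1%:M) (ps_star (ps_var N) (ps_cst A))) S /\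
    f =1 ps_add (ps_cst (ps_value f 0))
           (ps_star (ps_star (ps_star (ps_var n) (ps_cst C)) S) (ps_cst B)).

Definition ps_rational n m (f : mxseries n m) : Prop :=
  ps_converges_near0 f /\ has_realization f.

End PowerSeries.

(* Main.v *)
(* Evaluating the resolvent shows that f has a realization (A, B, C) iff
   f (k + 1) = C A^k B for all k.  Such coefficients grow at most geometrically
   (in an entrywise l1 norm, which is submultiplicative), so convergence near 0
   is automatic and only the state-space identities matter.  The sum is realized
   by the direct sum of the two systems, the star-product by their cascade, and
   the star-inverse by the feedback system
   (A - B D^-1 C, B D^-1, - D^-1 C) with D = f(0). *)
Require Import Defs.
From mathcomp Require Import all_boot all_order all_algebra complex.
From mathcomp Require Import all_classical all_reals all_analysis.
From mathcomp Require Import lra.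

Set Implicit Arguments.
Unset Strict Implicit.
Unset Printing Implicit Defensive.

Import Order.TTheory GRing.Theory Num.Theory.
Import numFieldNormedType.Exports.
Local Open Scope ring_scope.

(** * Submultiplicative seminorms and entrywise l1 norms of matrices *)

Section EntrywiseNorm.
Context {K : realFieldType}.

(** Stated over an arbitrary ring so as to apply in turn to complex numbers, to [Ht t] and to square
    matrices over [Ht t]. *)
Definition submul_seminorm (T : pzRingType) (nu : T -> K) :=
  [/\ nu 0 = 0, forall x, 0 <= nu x,
      forall x y, nu (x + y) <= nu x + nu y &
      forall x y, nu (x * y) <= nu x * nu y].

Definition mx_l1 (T : Type) (nu : T -> K) n m (M : 'M[T]_(n, m)) : K :=
  \sum_i \sum_j nu (M i j).

(** The factor [nu 1] accounts for [k = 0]: the l1 norm of an identity matrix grows with its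
    size. *)
Lemma seminorm_exp (T : pzRingType) (nu : T -> K) (x : T) k :
  submul_seminorm nu -> nu (x ^+ k) <= nu 1 * nu x ^+ k.
Proof.
move=> [_ nu0 _ nuM]; elim: k => [|k IH]; first by rewrite mulr1.
rewrite !exprSr mulrA; apply: le_trans (nuM _ _) _.
exact: ler_wpM2r.
Qed.

Section Entries.
Context (T : pzRingType) (nu : T -> K) (nuP : submul_seminorm nu).

Lemma mx_l1_ge0 n m (M : 'M[T]_(n, m)) : 0 <= mx_l1 nu M.
Proof. by case: nuP => _ h _ _; apply: sumr_ge0 => i _; apply: sumr_ge0. Qed.

Lemma ler_mx_l1 n m (M : 'M[T]_(n, m)) i j : nu (M i j) <= mx_l1 nu M.
Proof.
case: nuP => _ h _ _.
rewrite /mx_l1 (bigD1 i) //= (bigD1 j) //= -addrA lerDl addr_ge0 //.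
  exact: sumr_ge0.
by apply: sumr_ge0 => i' _; apply: sumr_ge0.
Qed.

Lemma seminorm_sum (I : Type) (r : seq I) (F : I -> T) :
  nu (\sum_(i <- r) F i) <= \sum_(i <- r) nu (F i).
Proof.
case: nuP => h0 _ hD _; elim/big_rec2: _ => [|i y x _ le]; first by rewrite h0.
exact: le_trans (hD _ _) (lerD _ _).
Qed.

Lemma mx_l1M n p m (M : 'M[T]_(n, p)) (N : 'M[T]_(p, m)) :
  mx_l1 nu (M *m N) <= mx_l1 nu M * mx_l1 nu N.
Proof.
case: nuP => _ h _ hM; rewrite /mx_l1 mulr_suml; apply: ler_sum => i _.
rewrite mulr_suml (le_trans (ler_sum _ _ : _ <= \sum_j \sum_k nu (M i k) * nu (N k j))) //.
  move=> j _; rewrite mxE; apply: le_trans (seminorm_sum _ _) _.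
  by apply: ler_sum => k _.
rewrite exchange_big; apply: ler_sum => k _; rewrite -mulr_sumr ler_wpM2l //.
(* The sum over row [k] of [N] is at most the sum over all rows. *)
by rewrite [leRHS](bigD1 k) //= lerDl; apply: sumr_ge0 => ? _; apply: sumr_ge0.
Qed.

Lemma mx_l1_seminorm n : submul_seminorm (fun M : 'M[T]_n => mx_l1 nu M).
Proof.
case: (nuP) => h0 h hD hM; split=> [|M|M N|M N].
- by rewrite /mx_l1 big1 // => i _; rewrite big1 // => j _; rewrite mxE.
- exact: mx_l1_ge0.
- rewrite /mx_l1 -big_split ler_sum // => i _; rewrite -big_split ler_sum // => j _.
  by rewrite mxE.
- exact: mx_l1M.
Qed.

End Entries.
End EntrywiseNorm.

(** * Convergence of complex series *)

Section ComplexSeries.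
Local Open Scope classical_set_scope.
Local Open Scope complex_scope.
Context {R : realType}.
Implicit Types z : R[i].

(** Takes values in [R], whereas the modulus takes values in [R[i]]; comparison with real geometric
    series thus applies directly. *)
Definition cplx_l1 z : R := `|complex.Re z| + `|complex.Im z|.

Lemma cplx_l1_seminorm : submul_seminorm cplx_l1.
Proof.
split=> [|[a b]|[a b] [c d]|[a b] [c d]]; rewrite /cplx_l1 /=.
- by rewrite normr0 addr0.
- by rewrite addr_ge0.
- by rewrite addrACA lerD // ler_normD.
- have := ler_normB (a * c) (b * d); have := ler_normD (a * d) (b * c).
  by rewrite !normrM; lra.
Qed.

Lemma ler_norm_cplx_l1 z : `|z| <= (cplx_l1 z)%:C.
Proof.
case: z => a b; rewrite normc_def lecR /cplx_l1 /=.
(* Writing the right side as the root of its square reduces the claim to a^2 + b^2 <= (|a| +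
   |b|)^2. *)
rewrite -[leRHS]ger0_norm ?addr_ge0 // -sqrtr_sqr ler_wsqrtr // sqrrD !real_normK ?num_real //.
by rewrite -addrA lerD2l lerDr mulrn_wge0 ?mulr_ge0.
Qed.

Lemma cplx_l1_lt z (e : R) : `|z| < e%:C -> cplx_l1 z < e + e.
Proof.
move=> ze; apply: ltrD; rewrite -ltcR; apply: le_lt_trans ze.
  exact: normc_ge_Re.
(* Multiplication by i turns the imaginary part into a real part up to sign, so the bound on real
   parts serves for both. *)
have zi : `|z * 'i| = `|z|.
  by rewrite normrM [ `|'i| ]normc_def /= expr0n expr1n add0r sqrtr1 mulr1.
by rewrite -zi; apply: le_trans (normc_ge_Re _); rewrite ReiNIm normrN.
Qed.

Lemma cvg_cplx (u : nat -> R[i]) (x y : R) :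
  (fun k => complex.Re (u k)) @ \oo --> x -> (fun k => complex.Im (u k)) @ \oo --> y ->
  (fun k => u k : (R[i])^o) @ \oo --> (x +i* y : (R[i])^o).
Proof.
move=> /cvgrPdist_lt ux /cvgrPdist_lt uy; apply/cvgrPdist_lt => -[e e'].
(* A positive element of [R[i]] has zero imaginary part, so the tolerance is a real [e]. *)
rewrite ltcE /= => /andP[/eqP -> e0].
have e20 : 0 < e / 2 by rewrite divr_gt0.
near=> k.
apply: le_lt_trans (ler_norm_cplx_l1 _) _.
have kx : `|x - complex.Re (u k)| < e / 2 by near: k; exact: ux.
have ky : `|y - complex.Im (u k)| < e / 2 by near: k; exact: uy.
rewrite ltcR /cplx_l1; case: (u k) kx ky => a b /= kx ky; lra.
Unshelve. all: by end_near. Qed.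

Lemma cvg_conjc (u : nat -> R[i]) (l : R[i]) :
  (u : nat -> (R[i])^o) @ \oo --> (l : (R[i])^o) ->
  (fun N => conjc (u N) : (R[i])^o) @ \oo --> (conjc l : (R[i])^o).
Proof.
move=> /cvgrPdist_lt ul; apply/cvgrPdist_lt => e /ul; apply: filterS => N.
by rewrite -rmorphB normcJ.
Qed.

Lemma cvg_cplxMl (c : R[i]) (u : nat -> R[i]) (l : R[i]) :
  (u : nat -> (R[i])^o) @ \oo --> (l : (R[i])^o) ->
  (fun N => c * u N : (R[i])^o) @ \oo --> (c * l : (R[i])^o).
Proof. by move=> ul; apply: cvgMl_tmp; exact: ul. Qed.

Lemma cvg_series_geometric (u : nat -> R) (a r : R) :
  0 <= r < 1 -> (forall k, `|u k| <= a * r ^+ k) ->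
  cvg ((fun N => \sum_(k < N) u k) @ \oo).
Proof.
move=> /andP[r0 r1] ub.
have -> : (fun N => \sum_(k < N) u k) = series u.
  by apply/funext => N; rewrite /series /= big_mkord.
apply: normed_cvg; apply: (@series_le_cvg _ _ (geometric a r)) => [k|k|k|].
- exact: normr_ge0.
- exact: le_trans (ub k).
- exact: ub.
- by apply: is_cvg_geometric_series; rewrite ger0_norm.
Qed.

Lemma cvg_cplx_series (u : nat -> R[i]) (a r : R) :
  0 <= r < 1 -> (forall k, cplx_l1 (u k) <= a * r ^+ k) ->
  exists l : R[i], (fun N => \sum_(k < N) u k : (R[i])^o) @ \oo --> (l : (R[i])^o).
Proof.
move=> r01 ub.
have uRe k : `|complex.Re (u k)| <= a * r ^+ k.
  by apply: le_trans (ub k); rewrite lerDl.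
have uIm k : `|complex.Im (u k)| <= a * r ^+ k.
  by apply: le_trans (ub k); rewrite lerDr.
have /cvg_ex[x ux] := cvg_series_geometric r01 uRe.
have /cvg_ex[y uy] := cvg_series_geometric r01 uIm.
have sumRe N : complex.Re (\sum_(k < N) u k) = \sum_(k < N) complex.Re (u k).
  by elim/big_rec2: _ => // i ? v _ <-; case: (u i) v => ? ? [].
have sumIm N : complex.Im (\sum_(k < N) u k) = \sum_(k < N) complex.Im (u k).
  by elim/big_rec2: _ => // i ? v _ <-; case: (u i) v => ? ? [].
exists (x +i* y); apply: cvg_cplx.
  by under eq_cvg do rewrite sumRe.
by under eq_cvg do rewrite sumIm.
Qed.

End ComplexSeries.

(** * Convergence of power series over [Ht t] *)

Section HtSeries.
Local Open Scope classical_set_scope.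
Local Open Scope complex_scope.
Context {R : realType} {t : R}.
Local Notation H := (Ht t).

Definition Ht_l1 (q : H) : R := mx_l1 (@cplx_l1 R) (Ht_val q).

Lemma Ht_l1_seminorm : submul_seminorm Ht_l1.
Proof.
have [h0 h hD hM] := mx_l1_seminorm (@cplx_l1_seminorm R) 2.
by split=> [|x|x y|x y]; [exact: h0|exact: h|exact: hD|exact: hM].
Qed.

Lemma nbhs_Ht_l1 (e : R) : 0 < e -> \forall q \near (0 : H), Ht_l1 q < e.
Proof.
(* Four entries, each of l1 norm below [d + d], add up to less than [e]. *)
move=> e0; pose d := e / 8.
have d0 : 0 < d by rewrite divr_gt0.
have vc := @initial_continuous _ _ (@Ht_val R t : H -> 'M[(R[i])^o]_2) (0 : H).
apply: (vc [set M : 'M[(R[i])^o]_2 | mx_l1 (@cplx_l1 R) M < e]).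
exists (fun _ _ => [set z : (R[i])^o | `|z| < d%:C]).
  move=> i j; have dC : 0 < d%:C by rewrite ltcR.
  apply: filterS (nbhsx_ballx (Ht_val (0 : H) i j : (R[i])^o) _ dC) => z.
  by rewrite -ball_normE /= mxE sub0r normrN.
move=> M Md /=; have {}Md i j : cplx_l1 (M i j) < e / 4.
  apply: lt_le_trans (cplx_l1_lt (Md i j)) _; rewrite /d; lra.
rewrite /mx_l1 !big_ord_recl !big_ord0.
move: (Md ord0 ord0) (Md ord0 (lift ord0 ord0)).
move: (Md (lift ord0 ord0) ord0) (Md (lift ord0 ord0) (lift ord0 ord0)); lra.
Qed.

Lemma cvg_Ht (x : nat -> H) (l : H) :
  (forall i j, (fun N => Ht_val (x N) i j : (R[i])^o) @ \oo --> (Ht_val l i j : (R[i])^o)) ->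
  x @ \oo --> l.
Proof.
move=> xl A [_ [[B oB <-] Bl BA]].
apply: filterS (_ : \forall N \near \oo, B (Ht_val (x N))) => [N BN|]; first exact: BA.
have [P Pl PB] := open_nbhs_nbhs (conj oB Bl).
apply: filterS (_ : \forall N \near \oo, forall i j, P i j (Ht_val (x N) i j)) => [N|].
  exact: PB.
apply: filter_forall => i; apply: filter_forall => j; exact: xl (Pl i j).
Qed.

(** Together with [Ht_val11], this makes the second column a continuous function of the first, so
    only the first column needs a convergence argument. *)
Lemma Ht_val01 (q : H) : Ht_val q 0 1 = t%:C * conjc (Ht_val q 1 0).
Proof. by case: q => M /= /is_qmatP[a [b ->]]; rewrite !qmatE conjcK. Qed.

Lemma Ht_val11 (q : H) : Ht_val q 1 1 = conjc (Ht_val q 0 0).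
Proof. by case: q => M /= /is_qmatP[a [b ->]]; rewrite !qmatE. Qed.

Lemma cvg_Ht_series (x : nat -> H) (a r : R) :
  0 <= r < 1 -> (forall k, Ht_l1 (x k) <= a * r ^+ k) ->
  exists l : H, (fun N => \sum_(k < N) x k) @ \oo --> l.
Proof.
move=> r01 xb.
have xe i j k : cplx_l1 (Ht_val (x k) i j) <= a * r ^+ k.
  exact: le_trans (ler_mx_l1 (@cplx_l1_seminorm R) _ _ _) (xb k).
have [l0 cl0] := cvg_cplx_series r01 (xe 0 0).
have [l1 cl1] := cvg_cplx_series r01 (xe 1 0).
(* Building the limit from its first column puts it in [Ht t] by construction; the limits of the
   second column then follow by conjugation. *)
have [l [l00 l10]] : exists l : H, Ht_val l 0 0 = l0 /\ Ht_val l 1 0 = l1.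
  have lP : qmat t l0 (conjc l1) \in is_qmat t by apply/is_qmatP; do 2 eexists.
  by exists (MkHt lP); rewrite /= !qmatE conjcK.
pose s N := \sum_(k < N) x k.
have sumE N i j : Ht_val (s N) i j = \sum_(k < N) Ht_val (x k) i j.
  rewrite -summxE; congr (fun_of_matrix _ i j); rewrite /s.
  by elim/big_rec2: _ => // ? ? ? _ <-.
have cvg_s i j (z : R[i]) :
    (fun N => \sum_(k < N) Ht_val (x k) i j : (R[i])^o) @ \oo --> (z : (R[i])^o) ->
    (fun N => Ht_val (s N) i j : (R[i])^o) @ \oo --> (z : (R[i])^o).
  rewrite (_ : (fun N => Ht_val (s N) i j) = (fun N => \sum_(k < N) Ht_val (x k) i j)) //.
  exact/funext.
have cvg00 : (fun N => Ht_val (s N) 0 0 : (R[i])^o) @ \oo --> (Ht_val l 0 0 : (R[i])^o).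
  by rewrite l00; apply: cvg_s.
have cvg10 : (fun N => Ht_val (s N) 1 0 : (R[i])^o) @ \oo --> (Ht_val l 1 0 : (R[i])^o).
  by rewrite l10; apply: cvg_s.
exists l; apply: (@cvg_Ht s) => i j.
have ord2 (k : 'I_2) : k = 0 \/ k = 1.
  by case: k => [[|[|]]] // ?; [left|right]; exact: val_inj.
have [->|->] := ord2 i; have [->|->] := ord2 j.
- exact: cvg00.
- rewrite Ht_val01 (funext (fun N => Ht_val01 (s N))).
  exact: cvg_cplxMl (cvg_conjc cvg10).
- exact: cvg10.
- rewrite Ht_val11 (funext (fun N => Ht_val11 (s N))).
  exact: cvg_conjc cvg00.
Qed.

Lemma cvg_mx (T : topologicalType) n m (x : nat -> 'M[T]_(n, m)) (l : 'M[T]_(n, m)) :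
  (forall i j, (fun N => x N i j) @ \oo --> l i j) -> x @ \oo --> l.
Proof.
move=> xl A [P Pl PA].
apply: filterS (_ : \forall N \near \oo, forall i j, P i j (x N i j)) => [N|].
  exact: PA.
by apply: filter_forall => i; apply: filter_forall => j; exact: xl (Pl i j).
Qed.

(** For [Ht_l1 q < a^-1], each entry of the series is dominated by a geometric series of ratio
    [Ht_l1 q * a < 1]. *)
Lemma geometric_ps_converges n m (f : mxseries t n m) (c a : R) :
  0 < a -> (forall k, mx_l1 Ht_l1 (f k) <= c * a ^+ k) -> ps_converges_near0 f.
Proof.
move=> a0 fb; have [_ h _ hM] := Ht_l1_seminorm.
have a1 : 0 < a^-1 by rewrite invr_gt0.
apply: filterS (nbhs_Ht_l1 a1) => q qa.
have qr : 0 <= Ht_l1 q * a < 1.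
  by rewrite mulr_ge0 ?h ?ltW //= -ltr_pdivlMr // mul1r.
have L i j : exists l : H, (fun N => \sum_(k < N) q ^+ k * f k i j) @ \oo --> l.
  apply: (@cvg_Ht_series (fun k => q ^+ k * f k i j) (Ht_l1 1 * c) _ qr) => k.
  apply: le_trans (hM _ _) _.
  have fk := le_trans (ler_mx_l1 Ht_l1_seminorm (f k) i j) (fb k).
  apply: le_trans (ler_pM (h _) (h _) (seminorm_exp q k Ht_l1_seminorm) fk) _.
  by rewrite exprMn mulrACA.
apply/cvg_ex; exists (\matrix_(i, j) projT1 (cid (L i j))); apply: cvg_mx => i j.
have -> : (fun N => ps_partial f q N i j) =
          (fun N => \sum_(k < N) q ^+ k * f k i j).
  apply/funext => N; rewrite /ps_partial summxE.
  by apply: eq_bigr => k _; rewrite mxE.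
by rewrite mxE; exact: projT2 (cid (L i j)).
Qed.

Lemma state_space_ps_converges n m (f : mxseries t n m) N (A : 'M[H]_N)
    (B : 'M[H]_(N, m)) (C : 'M[H]_(n, N)) :
  (forall k, f k.+1 = C *m A ^+ k *m B) -> ps_converges_near0 f.
Proof.
move=> ef; have hS := Ht_l1_seminorm.
pose nu p q (M : 'M[H]_(p, q)) := mx_l1 Ht_l1 M.
have nu0 p q (M : 'M[H]_(p, q)) : 0 <= nu p q M by exact: mx_l1_ge0.
(* Adding 1 gives [a >= 1], so [a] is positive and the bound in [a ^+ k] on [f k.+1] extends to
   [a ^+ k.+1]. *)
pose a := nu _ _ A + 1.
have a1 : 1 <= a by rewrite lerDr.
have a0 : 0 < a by exact: lt_le_trans a1.
pose c := nu _ _ C * nu _ _ (1%:M : 'M[H]_N) * nu _ _ B.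
(* The summand [nu (f 0)] absorbs the constant term, which the state-space formula does not
   constrain. *)
apply: (@geometric_ps_converges _ _ _ (nu _ _ (f 0%N) + c) a) => // -[|k].
  by rewrite mulr1 lerDl !mulr_ge0.
have fc : nu _ _ (f k.+1) <= c * a ^+ k.
  rewrite ef /c; apply: le_trans (mx_l1M hS _ _) _.
  rewrite mulrAC ler_wpM2r //; apply: le_trans (mx_l1M hS _ _) _.
  rewrite -mulrA ler_wpM2l //.
  apply: le_trans (seminorm_exp A k (mx_l1_seminorm hS N)) _.
  by rewrite ler_wpM2l // lerXn2r ?nnegrE ?nu0 ?ltW // /a ltrDl.
apply: le_trans fc _; apply: ler_pM.
- by rewrite !mulr_ge0.
- by rewrite exprn_ge0 // ltW.
- by rewrite lerDr.
- by rewrite ler_weXn2l.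
Qed.

End HtSeries.

(** * Star-product calculus, resolvents and state-space realizations *)

Section Realizations.
Context {R : realType} {t : R}.
Local Notation H := (Ht t).
Local Notation mxseries := (mxseries t).

Lemma expmxS N (A : 'M[H]_N) k : A ^+ k.+1 = A *m A ^+ k.
Proof. exact: exprS. Qed.

(** The series q * M; star-multiplication by it shifts coefficients by one, which turns the
    resolvent identity into a recursion. *)
Definition ps_monomial n m (M : 'M[H]_(n, m)) : mxseries n m :=
  fun k => if k == 1%N then M else 0.

Lemma eq_ps_star n p m (f f' : mxseries n p) (g g' : mxseries p m) :
  f =1 f' -> g =1 g' -> ps_star f g =1 ps_star f' g'.
Proof. by move=> ef eg k; apply: eq_bigr => i _; rewrite ef eg. Qed.

Lemma ps_star_cstl n p m (M : 'M[H]_(n, p)) (g : mxseries p m) k :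
  ps_star (ps_cst M) g k = M *m g k.
Proof.
rewrite /ps_star big_ord_recr /= subnn /ps_cst eqxx big1 ?add0r // => i _.
by rewrite subn_eq0 leqNgt ltn_ord mul0mx.
Qed.

Lemma ps_star_cstr n p m (f : mxseries n p) (M : 'M[H]_(p, m)) k :
  ps_star f (ps_cst M) k = f k *m M.
Proof.
rewrite /ps_star big_ord_recl /= subn0 /ps_cst eqxx big1 ?addr0 // => i _.
by rewrite mulmx0.
Qed.

Lemma ps_star_monomiall n p m (M : 'M[H]_(n, p)) (g : mxseries p m) k :
  ps_star (ps_monomial M) g k = if k is k'.+1 then M *m g k' else 0.
Proof.
case: k => [|k]; first by rewrite /ps_star big_ord1 /ps_monomial /= mul0mx.
rewrite /ps_star !big_ord_recr /= subnn subSnn /ps_monomial /= mul0mx addr0.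
rewrite big1 ?add0r // => i _.
by rewrite subSn 1?ltnW // eqSS subn_eq0 leqNgt ltn_ord mul0mx.
Qed.

Lemma ps_star_monomialr n p m (f : mxseries n p) (M : 'M[H]_(p, m)) k :
  ps_star f (ps_monomial M) k = if k is k'.+1 then f k' *m M else 0.
Proof.
case: k => [|k]; first by rewrite /ps_star big_ord1 /ps_monomial /= mulmx0.
rewrite /ps_star !big_ord_recl /= subSS !subn0 /ps_monomial /= mulmx0 add0r.
by rewrite big1 ?addr0 // => i _; rewrite mulmx0.
Qed.

Lemma ps_star_varl n m (M : 'M[H]_(n, m)) :
  ps_star (ps_var n) (ps_cst M) =1 ps_monomial M.
Proof.
by move=> k; rewrite ps_star_cstr /ps_var /ps_monomial; case: eqP; rewrite ?mul1mx ?mul0mx.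
Qed.

Lemma ps_starBl n p m (f g : mxseries n p) (h : mxseries p m) :
  ps_star (ps_sub f g) h =1 ps_sub (ps_star f h) (ps_star g h).
Proof.
move=> k; rewrite /ps_sub /ps_star -sumrB; apply: eq_bigr => i _.
by rewrite mulmxBl.
Qed.

Lemma ps_starBr n p m (f : mxseries n p) (g h : mxseries p m) :
  ps_star f (ps_sub g h) =1 ps_sub (ps_star f g) (ps_star f h).
Proof.
move=> k; rewrite /ps_sub /ps_star -sumrB; apply: eq_bigr => i _.
by rewrite mulmxBr.
Qed.

(** Comparing coefficients in (1 - q A) * S = 1 gives S_0 = 1 and S_(k+1) = A S_k, whence the
    geometric series; the powers of [A] commute with [A], so this series is also a left inverse. *)
Lemma resolventP N (A : 'M[H]_N) (S : mxseries N N) :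
  ps_star_inverse (ps_sub (ps_cst 1%:M) (ps_star (ps_var N) (ps_cst A))) S <->
  S =1 GRing.exp A.
Proof.
have eT : ps_sub (ps_cst 1%:M) (ps_star (ps_var N) (ps_cst A)) =1
          ps_sub (ps_cst 1%:M) (ps_monomial A).
  by move=> k; rewrite /ps_sub ps_star_varl.
split=> [[+ _] k|eS].
- move=> /(fun e k => etrans (esym (eq_ps_star eT (frefl S) k)) (e k)) e.
  elim: k => [|k IH]; have := e _.
    move/(_ 0%N); rewrite ps_starBl /ps_sub ps_star_cstl ps_star_monomiall.
    by rewrite subr0 mul1mx.
  move/(_ k.+1); rewrite ps_starBl /ps_sub ps_star_cstl ps_star_monomiall mul1mx.
  by move/subr0_eq->; rewrite IH expmxS.
- split=> k.
    rewrite (eq_ps_star eT eS) ps_starBl /ps_sub ps_star_cstl mul1mx.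
    by rewrite ps_star_monomiall; case: k => [|k]; rewrite ?subr0 // expmxS subrr.
  rewrite (eq_ps_star eS eT) ps_starBr /ps_sub ps_star_cstr mulmx1.
  by rewrite ps_star_monomialr; case: k => [|k]; rewrite ?subr0 // exprSr subrr.
Qed.

Lemma has_realizationP n m (f : mxseries n m) :
  has_realization f <->
  exists N (A : 'M[H]_N) (B : 'M[H]_(N, m)) (C : 'M[H]_(n, N)),
    forall k, f k.+1 = C *m A ^+ k *m B.
Proof.
have cf N (A : 'M[H]_N) (B : 'M[H]_(N, m)) (C : 'M[H]_(n, N)) S k :
    S =1 GRing.exp A ->
    ps_star (ps_star (ps_star (ps_var n) (ps_cst C)) S) (ps_cst B) k =
    if k is k'.+1 then C *m A ^+ k' *m B else 0.
  move=> eS; rewrite ps_star_cstr (eq_ps_star (ps_star_varl C) eS).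
  by rewrite ps_star_monomiall; case: k => //; rewrite mul0mx.
split=> -[N [A [B [C]]]].
- move=> [S [/resolventP eS ef]]; exists N, A, B, C => k.
  by rewrite ef /ps_add (cf _ _ _ _ _ _ eS) add0r.
- move=> ef; exists N, A, B, C, (GRing.exp A); split; first exact/resolventP.
  by case=> [|k]; rewrite /ps_add (cf _ _ _ _ _ _ (frefl _)) ps_value0 /ps_cst ?addr0 // add0r -ef.
Qed.

(** The initial state [X 0] serves as input matrix, since X_k = A^k X_0. A realization is thereby
    checked through a one-step recursion, without computing powers of block matrices. *)
Lemma realization_state n m (f : mxseries n m) N (A : 'M[H]_N)
    (C : 'M[H]_(n, N)) (X : nat -> 'M[H]_(N, m)) :
  (forall k, X k.+1 = A *m X k) -> (forall k, f k.+1 = C *m X k) ->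
  has_realization f.
Proof.
move=> XS fX; apply/has_realizationP; exists N, A, (X 0%N), C => k.
rewrite fX -mulmxA; congr (_ *m _).
by elim: k => [|k IH]; rewrite ?mul1mx // XS IH expmxS mulmxA.
Qed.

Lemma ps_star_recr n p m (f : mxseries n p) (g : mxseries p m) k :
  ps_star f g k.+1 =
    ps_star (fun i => f i.+1) g k + f 0%N *m g k.+1.
Proof.
rewrite /ps_star big_ord_recr /= subnn; congr (_ + _).
by apply: eq_bigr => i _; rewrite subSn // -ltnS.
Qed.

Lemma mul_ps_star n p q m (M : 'M[H]_(q, n)) (f : mxseries n p) (g : mxseries p m) k :
  M *m ps_star f g k = ps_star (fun i => M *m f i) g k.
Proof. by rewrite mulmx_sumr; apply: eq_bigr => i _; rewrite mulmxA. Qed.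

(* X is the state sequence of the system (A, B, C) fed with the input g. *)
Lemma ps_star_state n p m (f : mxseries n p) (g : mxseries p m) N (A : 'M[H]_N)
    (B : 'M[H]_(N, p)) (C : 'M[H]_(n, N))
    (X := ps_star (fun i => A ^+ i *m B) g) :
  (forall k, f k.+1 = C *m A ^+ k *m B) ->
  [/\ X 0%N = B *m g 0%N,
      forall k, X k.+1 = A *m X k + B *m g k.+1 &
      forall k, ps_star f g k.+1 = C *m X k + f 0%N *m g k.+1].
Proof.
move=> ef; split=> [|k|k].
- by rewrite /X /ps_star big_ord1 subnn mul1mx.
- rewrite /X ps_star_recr mul1mx mul_ps_star; congr (_ + _).
  by apply: eq_bigr => i _; rewrite expmxS mulmxA.
- rewrite ps_star_recr mul_ps_star; congr (_ + _).
  by apply: eq_bigr => i _; rewrite ef mulmxA.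
Qed.

(** * Realizations of sums, star-products and star-inverses *)

Lemma has_realization_add n m (f g : mxseries n m) :
  has_realization f -> has_realization g -> has_realization (ps_add f g).
Proof.
move=> /has_realizationP[N1 [A1 [B1 [C1 ef]]]].
move=> /has_realizationP[N2 [A2 [B2 [C2 eg]]]].
apply: (realization_state (A := block_mx A1 0 0 A2) (C := row_mx C1 C2)
          (X := fun k => col_mx (A1 ^+ k *m B1) (A2 ^+ k *m B2))) => k.
  by rewrite mul_block_col !mul0mx addr0 add0r !expmxS !mulmxA.
by rewrite mul_row_col /ps_add ef eg !mulmxA.
Qed.

(** The system of [g] evolves on its own and its output [C2] drives the system of [f] through [B1].
    The direct term f_0 g_(k+1) contributes the block [f 0 *m C2] to the output. *)
Lemma has_realization_star n p m (f : mxseries n p) (g : mxseries p m) :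
  has_realization f -> has_realization g -> has_realization (ps_star f g).
Proof.
move=> /has_realizationP[N1 [A1 [B1 [C1 ef]]]].
move=> /has_realizationP[N2 [A2 [B2 [C2 eg]]]].
have [_ XS fgX] := ps_star_state g ef.
apply: (realization_state (A := block_mx A1 (B1 *m C2) 0 A2)
          (C := row_mx C1 (f 0%N *m C2))
          (X := fun k => col_mx (ps_star (fun i => A1 ^+ i *m B1) g k)
                                (A2 ^+ k *m B2))) => k.
  by rewrite mul_block_col mul0mx add0r XS eg expmxS !mulmxA.
by rewrite mul_row_col fgX eg !mulmxA.
Qed.

(** Feeding [g] to the system of [f] must give zero output: C X_k + D g_(k+1) = 0. Hence g_(k+1) = -
    D^-1 C X_k, and substitution in the state equation gives X_(k+1) = (A - B D^-1 C) X_k with X_0 =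
    B D^-1. *)
Lemma has_realization_star_inverse n (f : mxseries n n) :
  has_realization f -> mx_invertible (f 0%N) ->
  exists g, ps_star_inverse f g /\ has_realization g.
Proof.
move=> /has_realizationP[N [A [B [C ef]]]] [D' [DD' D'D]].
pose A' := A - B *m D' *m C.
pose g k := if k is k'.+1 then - D' *m C *m A' ^+ k' *m (B *m D') else D'.
have eg k : g k.+1 = - D' *m C *m A' ^+ k *m (B *m D') by [].
have A'M p (X : 'M[H]_(N, p)) : A' *m X = A *m X - B *m (D' *m (C *m X)).
  by rewrite mulmxBl !mulmxA.
exists g; split; last by apply/has_realizationP; exists N, A', (B *m D'), (- D' *m C).
split=> k.
- have [X0 XS fgX] := ps_star_state g ef.
  have eX i : ps_star (fun j => A ^+ j *m B) g i = A' ^+ i *m (B *m D').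
    elim: i => [|i IH]; first by rewrite X0 mul1mx.
    by rewrite XS IH eg expmxS -[in RHS]mulmxA A'M !mulNmx mulmxN !mulmxA.
  case: k => [|k]; first by rewrite /ps_star big_ord1 /ps_cst.
  by rewrite fgX eX eg !mulNmx mulmxN !mulmxA DD' mul1mx subrr.
- have [X0 XS gfX] := ps_star_state f eg.
  (* In the other order the feedback cancels: the input adds back the term [B *m D' *m C] subtracted
     in [A'], leaving the free evolution under [A]. *)
  have eX i : ps_star (fun j => A' ^+ j *m (B *m D')) f i = A ^+ i *m B.
    elim: i => [|i IH]; first by rewrite X0 mul1mx -mulmxA D'D mulmx1.
    by rewrite XS IH ef A'M expmxS !mulmxA subrK.
  case: k => [|k]; first by rewrite /ps_star big_ord1 /ps_cst.
  by rewrite gfX eX ef !mulNmx !mulmxA addNr.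
Qed.

(** Strong induction: the coefficient of index [k] is f_0 g_k plus terms in the g_i with i < k, and
    f_0 has a left inverse. *)
Lemma ps_star_cancell n m (f : mxseries n n) (g h : mxseries n m) :
  mx_invertible (f 0%N) -> ps_star f g =1 ps_star f h -> g =1 h.
Proof.
move=> [D' [_ D'D]] e k; elim/ltn_ind: k => k IH.
have /(congr1 (mulmx D')) := e k.
rewrite /ps_star !big_ord_recr /= subnn !mulmxDr !mulmxA D'D !mul1mx.
rewrite (eq_bigr (fun i : 'I_k => f (k - i)%N *m h i)); first by move/addrI.
by move=> i _; rewrite IH.
Qed.

Lemma ps_rationalE n m (f : mxseries n m) : ps_rational f <-> has_realization f.
Proof.
split=> [[]//|rf]; split=> //.
by have [N [A [B [C ef]]]] := (has_realizationP f).1 rf; exact: state_space_ps_converges ef.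
Qed.

End Realizations.

Theorem theorem7p5 (R : realType) (t : R) (ht : t != 0) :
  (forall (n m : nat) (f g : mxseries t n m),
      ps_rational f -> ps_rational g -> ps_rational (ps_add f g)) /\
  (forall (n p m : nat) (f : mxseries t n p) (g : mxseries t p m),
      ps_rational f -> ps_rational g -> ps_rational (ps_star f g)) /\
  (forall (n : nat) (f : mxseries t n n),
      ps_rational f -> mx_invertible (ps_value f 0) ->
      (exists g : mxseries t n n, ps_star_inverse f g) /\
      (forall g : mxseries t n n, ps_star_inverse f g -> ps_rational g)).
Proof.
split; [|split] => [n m f g|n p m f g|n f].
- by rewrite !ps_rationalE; exact: has_realization_add.
- by rewrite !ps_rationalE; exact: has_realization_star.
- rewrite ps_rationalE ps_value0 => rf f0.
  have [h [[fh hf] rh]] := has_realization_star_inverse rf f0.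
  split=> [|g [fg gf]]; first by exists h.
  (* Both [g] and [h] are right star-inverses of [f], so cancelling [f] identifies an arbitrary
     star-inverse with the constructed one. *)
  suff -> : g = h by apply/ps_rationalE.
  by apply/funext/(ps_star_cancell f0) => k; rewrite fg fh.
Qed.
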